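(* Let $f\colon K\to L$ be a simplicial map between two filtered simplicial complexes admitting a section $s\colon L\to K$. Let $X$ and $Y$ be the filtered chain complexes induced by the filtrations of $K$ and $L$, and denote again by $f\colon X\to Y$ and $s\colon Y\to X$ the induced morphisms of filtered chain complexes. Then the set of elements $$\{\sigma-sf(\sigma)\ \mid\ \sigma\in K,\ \sigma\notin\mathrm{im}(s)\},$$ where $\sigma-sf(\sigma)$ is given the degree $\deg(\sigma)$ and the entrance time $\mathrm{ent}(\sigma)$, is a quasi-minimal set of generators of the filtered kernel $\ker f$; in particular, for every $n\in\mathbb{N}$ and $t\in[0,\infty)$, the elements $\sigma-sf(\sigma)$ with $\sigma\notin\mathrm{im}(s)$, $\deg(\sigma)=n$ and $\mathrm{ent}(\sigma)\le t$ form a basis of $\ker f_n^t$.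
   Context: $\mathbb{F}$ is a finite prime field. Chain complexes are non-negatively graded complexes of $\mathbb{F}$-vector spaces and are assumed compact, i.e. $\bigoplus_n C_n$ is finite dimensional (in particular the simplicial complexes are finite); $\mathbf{ch}$ is the category of these. A functor $X\colon[0,\infty)\to\mathbf{ch}$ has values $X^t$ and transition morphisms $X^{s\le t}$; $X_n^t$ is the degree $n$ part of $X^t$. $X$ is tame if there is a finite sequence $0=\tau_0<\dots<\tau_k$ such that $X^{s\le t}$ may fail to be an isomorphism only when $s<\tau_a\le t$ for some $a\in\{1,\dots,k\}$. A filtered chain complex is a tame $X$ all of whose transition morphisms are monomorphisms. Generators: each generator $x$ has a degree $n$ and an entrance time $t$, with $x\in X_n^t$; a finite set $\mathcal G$ of such elements generates $X$ if the elements, their images under transition morphisms, and the differentials of these span every $X_n^t$. The radical $\mathrm{rad}X_n\subset X_n$ has value at $t$ the sum of the images of $X_n^{s<t}$ over all $s<t$. $\mathcal G$ is quasi-minimal if for all $n$ and $t$ the set of $x\in\mathcal G$ with entrance time $t$ and degree $n$ is (maps bijectively onto) a basis of $(X_n/\mathrm{rad}X_n)^t$. Elements are identified with their images under the (injective) transition morphisms. Filtered simplicial complexes: each simplex $\sigma$ has a degree $\deg(\sigma)$ (its dimension) and an entrance time $\mathrm{ent}(\sigma)\in[0,\infty)$ given by the filtration; the filtered chain complex induced by $K$ has at $t$ the simplicial chain complex over $\mathbb{F}$ of the subcomplex of simplices with entrance time $\le t$, with inclusions as transition morphisms. Simplicial maps here are compatible with the filtrations: $\mathrm{ent}(\sigma)\ge\mathrm{ent}(f(\sigma))$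 (and $\deg(\sigma)\ge\deg(f(\sigma))$ always). The induced morphism $f\colon X\to Y$ is the usual simplicial chain map: a simplex $\sigma$ of dimension $n$ is sent to $f(\sigma)$ (with the induced orientation) if $\dim f(\sigma)=n$ and to $0$ otherwise. A section is a simplicial map $s\colon L\to K$, compatible with the filtrations, with $f s=\mathrm{id}_L$; then $\mathrm{ent}(s(\tau))=\mathrm{ent}(\tau)$ and $\deg(s(\tau))=\deg(\tau)$ for every $\tau\in L$. In $\sigma-sf(\sigma)$ the maps $s,f$ are the induced chain morphisms, and $\sigma\notin\mathrm{im}(s)$ means that the simplex $\sigma$ is not of the form $s(\tau)$ with $\tau\in L$. The filtered kernel $\ker f$ is the filtered chain complex with $(\ker f)_n^t=\ker(f_n^t\colon X_n^t\to Y_n^t)$, and transition morphisms and differentials induced by those of $X$. *)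

(* Defs.v *)
From HB Require Import structures.
From mathcomp Require Import all_boot all_order all_algebra.
From mathcomp Require Import boolp classical_sets functions cardinality reals.
From mathcomp Require Import interval_inference.
From mathcomp Require Import ring zify.

Set Implicit Arguments.
Unset Strict Implicit.
Unset Printing Implicit Defensive.

Import Order.TTheory GRing.Theory Num.Theory.

Local Open Scope ring_scope.

Section LinearAlgebra.
Variables (F : fieldType) (V : vectType F).
Implicit Types (U W : {vspace V}) (v : V).

Definition spanning (A : set V) : Prop :=
  forall v, exists b : seq V, (forall x, x \in b -> A x) /\ v \in <<b>>%VS.

Definition basis_set (A : set V) : Prop :=
  exists b : seq V, basis_of fullv b /\ forall x, A x <-> x \in b.

(* The quotient V / U, realised on a complement of U: [quo_proj U] is a linear
   surjection of kernel U, see [lker_quo_proj] and [limg_quo_proj]. *)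
Definition quo U : vectType F := subvs_of (U^C)%VS.

Definition quo_proj U : 'Hom(V, quo U) :=
  (linfun (vsproj (U^C)%VS) \o daddv_pi (U^C)%VS U)%VF.

Lemma lker_quo_proj U : lker (quo_proj U) = U.
Proof.
have dUC : (U^C :&: U = 0)%VS by rewrite capvC capv_compl.
apply/vspaceP => v; rewrite memv_ker /quo_proj comp_lfunE lfunE /=.
have vE : daddv_pi (U^C)%VS U v + daddv_pi U (U^C)%VS v = v.
  by apply: daddv_pi_add => //; rewrite addvC addv_complf memvf.
have mC := memv_pi (U^C)%VS U v.
apply/eqP/idP => [/(congr1 vsval)|vU].
  rewrite vsprojK //= => h; move: vE; rewrite h add0r => <-.
  exact: memv_pi.
apply: val_inj; rewrite /= vsprojK //.
apply/eqP; rewrite -memv0 -dUC memv_cap mC /=.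
rewrite -[daddv_pi _ _ v](addrK (daddv_pi U (U^C)%VS v)) vE.
by rewrite memvB // memv_pi.
Qed.

Lemma limg_quo_proj U : limg (quo_proj U) = fullv.
Proof.
have dUC : (U^C :&: U = 0)%VS by rewrite capvC capv_compl.
apply/eqP; rewrite eqEsubv subvf /=; apply/subvP => w _.
apply/memv_imgP; exists (vsval w); first exact: memvf.
by rewrite comp_lfunE lfunE /= daddv_pi_id ?vsvalK // subvsP.
Qed.

Section SumOfFamily.
Variables (I : Type) (U : I -> {vspace V}).

Lemma sumv_fam_exists :
  exists W, `[< forall v, v \in W <-> exists r : seq I, v \in (\sum_(i <- r) U i)%VS >].
Proof.
have [r rmax] : exists r : seq I, forall r' : seq I,
    (\dim (\sum_(i <- r') U i)%VS <= \dim (\sum_(i <- r) U i)%VS)%N.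
  pose P d := `[< exists r : seq I, d = \dim (\sum_(i <- r) U i)%VS >].
  have exP : exists d, P d.
    by exists (\dim (\sum_(i <- [::]) U i)%VS); apply/asboolP; exists [::].
  have ubP d : P d -> (d <= \dim {: V})%N.
    by move=> /asboolP[r ->]; apply: dimvS; apply: subvf.
  have [d /asboolP[r dE] dmax] := ex_maxnP exP ubP.
  by exists r => r'; rewrite -dE; apply: dmax; apply/asboolP; exists r'.
exists (\sum_(i <- r) U i)%VS; apply/asboolP => v; split; first by exists r.
move=> [r' vr'].
have sub : (\sum_(i <- r) U i <= \sum_(i <- r ++ r') U i)%VS.
  by rewrite big_cat /= addvSl.
have := rmax (r ++ r'); rewrite (geq_leqif (dimv_leqif_sup sub)) => /subvP; apply.
by rewrite big_cat /=; apply: subvP (addvSr _ _) _ vr'.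
Qed.

(* The sum of an arbitrary family of subspaces, see [memv_sumv_fam]. *)
Definition sumv_fam : {vspace V} := xchoose sumv_fam_exists.

Lemma memv_sumv_fam v :
  v \in sumv_fam <-> exists r : seq I, v \in (\sum_(i <- r) U i)%VS.
Proof. by have /asboolP/(_ v) := xchooseP sumv_fam_exists. Qed.

End SumOfFamily.

End LinearAlgebra.

Section FilteredChainComplexes.
Variables (F : fieldType) (R : realType).
Implicit Types r s t : {nonneg R}.

Record chain_complex := ChainComplex {
  ch_obj :> nat -> vectType F;
  ch_d : forall n, 'Hom(ch_obj n.+1, ch_obj n);
  ch_dd : forall n, (ch_d n \o ch_d n.+1 = 0)%VF;
  ch_compact : exists N, forall n, (N <= n)%N -> \dim {: ch_obj n} = 0%N
}.

Record chain_map (C D : chain_complex) := ChainMap {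
  cm_fun :> forall n, 'Hom(C n, D n);
  cm_d : forall n, (cm_fun n \o ch_d C n = ch_d D n \o cm_fun n.+1)%VF
}.

Definition chain_iso (C D : chain_complex) (g : chain_map C D) : Prop :=
  exists h : chain_map D C,
    forall n, (h n \o g n = \1)%VF /\ (g n \o h n = \1)%VF.

Record pers_complex := PersComplex {
  pc_val :> {nonneg R} -> chain_complex;
  pc_tr : forall s t, s <= t -> chain_map (pc_val s) (pc_val t);
  pc_tr_id : forall t (tt : t <= t) n, pc_tr tt n = \1%VF;
  pc_tr_comp : forall r s t (rs : r <= s) (st : s <= t) (rt : r <= t) n,
    pc_tr rt n = (pc_tr st n \o pc_tr rs n)%VF
}.

Definition tame (X : pers_complex) : Prop :=
  exists2 tau : seq {nonneg R}, path <%O 0%:nng tau &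
    forall s t (st : s <= t),
      (forall a, a \in tau -> ~ (s < a <= t)) -> chain_iso (pc_tr X st).

Record filtered_complex := FilteredComplex {
  fc_pers :> pers_complex;
  fc_tame : tame fc_pers;
  fc_mono : forall s t (st : s <= t) n, injective (pc_tr fc_pers st n)
}.

Record pers_map (X Y : pers_complex) := PersMap {
  pm_fun :> forall t, chain_map (X t) (Y t);
  pm_nat : forall s t (st : s <= t) n,
    (pm_fun t n \o pc_tr X st n = pc_tr Y st n \o pm_fun s n)%VF
}.

Section Generators.
Variable X : pers_complex.

Record generator := Generator {
  gen_deg : nat;
  gen_ent : {nonneg R};
  gen_elt : X gen_ent gen_deg
}.

Local Open Scope classical_set_scope.

Definition gens_at (G : set generator) n t : set (X t n) :=
  [set x | G (@Generator n t x)].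
Arguments gens_at : clear implicits.

(* The elements of G themselves are the case s = t. *)
Definition generates (G : set generator) : Prop :=
  finite_set G /\
  forall n t, spanning
    ([set x : X t n | exists (s : {nonneg R}) (st : s <= t),
        exists2 y, gens_at G n s y & x = pc_tr X st n y] `|`
     [set x : X t n | exists (s : {nonneg R}) (st : s <= t),
        exists2 y, gens_at G n.+1 s y & x = ch_d (X t) n (pc_tr X st n.+1 y)]).

Definition rad n t : {vspace X t n} :=
  sumv_fam (fun s : {s : {nonneg R} | s < t} =>
    limg (pc_tr X (ltW (valP s)) n)).

Definition quasi_minimal (G : set generator) : Prop :=
  forall n t,
    set_inj (gens_at G n t) (quo_proj (rad n t)) /\
    basis_set (quo_proj (rad n t) @` gens_at G n t).

End Generators.

Section SubvsMap.
Variables (V W : vectType F) (A : {vspace V}) (B : {vspace W}).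

(* Meaningful only when g maps A into B, see [subvs_mapE]. *)
Definition subvs_map (g : 'Hom(V, W)) : 'Hom(subvs_of A, subvs_of B) :=
  (linfun (vsproj B) \o (g \o linfun vsval))%VF.

Lemma subvs_mapE (g : 'Hom(V, W)) : (forall v, v \in A -> g v \in B) ->
  forall x, vsval (subvs_map g x) = g (vsval x).
Proof.
by move=> gAB x; rewrite !comp_lfunE !lfunE /= vsprojK // gAB // subvsP.
Qed.

End SubvsMap.

Section Kernel.
Variables (X Y : filtered_complex) (f : pers_map X Y).

Local Notation ker t n := (lker (f t n)).

Lemma ker_d t n v : v \in ker t n.+1 -> ch_d (X t) n v \in ker t n.
Proof.
rewrite !memv_ker => /eqP fv0.
by rewrite -comp_lfunE (cm_d (f t) n) comp_lfunE fv0 linear0.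
Qed.

Lemma ker_tr s t (st : s <= t) n v :
  v \in ker s n -> pc_tr X st n v \in ker t n.
Proof.
rewrite !memv_ker => /eqP fv0.
by rewrite -comp_lfunE (pm_nat f) comp_lfunE fv0 linear0.
Qed.

Lemma ker_dd t n : (subvs_map (ker t n.+1) (ker t n) (ch_d (X t) n) \o
  subvs_map (ker t n.+2) (ker t n.+1) (ch_d (X t) n.+1) = 0)%VF.
Proof.
apply/lfunP => x; apply: subvs_inj.
rewrite comp_lfunE /= !subvs_mapE; try exact: ker_d.
by rewrite -comp_lfunE ch_dd !lfunE.
Qed.

Lemma ker_compact t : exists N, forall n, (N <= n)%N ->
  \dim {: subvs_of (ker t n)} = 0%N.
Proof.
have [N dimN] := ch_compact (X t); exists N => n /dimN dim0.
apply/eqP; rewrite dimvf /dim /= -leqn0 -[X in (_ <= X)%N]dim0.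
exact: dimvS (subvf _).
Qed.

Definition ker_complex t : chain_complex :=
  @ChainComplex (fun n => subvs_of (ker t n))
    (fun n => subvs_map (ker t n.+1) (ker t n) (ch_d (X t) n))
    (ker_dd t) (ker_compact t).

Lemma ker_tr_d s t (st : s <= t) n :
  (subvs_map (ker s n) (ker t n) (pc_tr X st n) \o ch_d (ker_complex s) n =
   ch_d (ker_complex t) n \o
     subvs_map (ker s n.+1) (ker t n.+1) (pc_tr X st n.+1))%VF.
Proof.
apply/lfunP => x; apply: subvs_inj.
rewrite [in LHS]comp_lfunE [in RHS]comp_lfunE /= !subvs_mapE;
  try exact: ker_d; try exact: ker_tr.
by rewrite -!comp_lfunE (cm_d (pc_tr X st)).
Qed.

Definition ker_transition s t (st : s <= t) :
    chain_map (ker_complex s) (ker_complex t) :=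
  @ChainMap (ker_complex s) (ker_complex t)
    (fun n => subvs_map (ker s n) (ker t n) (pc_tr X st n)) (ker_tr_d st).

Lemma ker_transition_id t (tt : t <= t) n : ker_transition tt n = \1%VF.
Proof.
apply/lfunP => x; apply: subvs_inj.
rewrite /= subvs_mapE; last exact: ker_tr.
by rewrite pc_tr_id !id_lfunE.
Qed.

Lemma ker_transition_comp r s t (rs : r <= s) (st : s <= t) (rt : r <= t) n :
  ker_transition rt n = (ker_transition st n \o ker_transition rs n)%VF.
Proof.
apply/lfunP => x; apply: subvs_inj.
rewrite comp_lfunE /= !subvs_mapE; try exact: ker_tr.
by rewrite (pc_tr_comp _ rs st) comp_lfunE.
Qed.

Definition ker_pers : pers_complex :=
  @PersComplex ker_complex ker_transition ker_transition_id
    ker_transition_comp.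

Lemma chain_iso_bij (C D : chain_complex) (g : chain_map C D) :
  (forall n, injective (g n) /\ limg (g n) = fullv) -> chain_iso g.
Proof.
move=> gbij.
have k0 n : lker (g n) == 0%VS by apply/lker0P; case: (gbij n).
have gK n : (g n \o (g n)^-1 = \1)%VF.
  apply/lfunP => y; rewrite comp_lfunE id_lfunE.
  by rewrite limg_lfunVK // (gbij n).2 memvf.
have Kg n : ((g n)^-1 \o g n = \1)%VF by apply: lker0_compVf.
have hd n : ((g n)^-1 \o ch_d D n = ch_d C n \o (g n.+1)^-1)%VF.
  apply/lfunP => y; rewrite -[y in LHS](id_lfunE y) -(gK n.+1) !comp_lfunE.
  rewrite -[ch_d D n _]comp_lfunE -(cm_d g) comp_lfunE.
  by rewrite -[(g n)^-1%VF _]comp_lfunE Kg id_lfunE.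
by exists (ChainMap hd).
Qed.

Lemma ker_mono s t (st : s <= t) n : injective (pc_tr ker_pers st n).
Proof.
move=> x y /(congr1 vsval); rewrite /= !subvs_mapE; try exact: ker_tr.
by move=> /(@fc_mono X _ _ st n) /subvs_inj.
Qed.

Lemma ker_tame : tame ker_pers.
Proof.
have [tau ptau iso_tau] := fc_tame X.
exists tau => // s t st /(iso_tau s t st)[h hK].
apply: chain_iso_bij => n; split; first exact: ker_mono.
apply/eqP; rewrite eqEsubv subvf /=; apply/subvP => w _.
have trh v : pc_tr X st n (h n v) = v.
  by rewrite -comp_lfunE (hK n).2 id_lfunE.
have hker : h n (vsval w) \in ker s n.
  rewrite memv_ker; apply/eqP; apply: (@fc_mono Y _ _ st n).
  rewrite -comp_lfunE -(pm_nat f) comp_lfunE trh linear0.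
  by apply/eqP; rewrite -memv_ker subvsP.
apply/memv_imgP; exists (Subvs hker); first exact: memvf.
apply: subvs_inj; rewrite /= subvs_mapE; last exact: ker_tr.
by rewrite /= trh.
Qed.

Definition filtered_kernel : filtered_complex :=
  FilteredComplex ker_tame ker_mono.

End Kernel.

End FilteredChainComplexes.

Section FreeVectorSpace.
Variables (F : fieldType) (T : finType).
Implicit Types (S : {set T}) (x : T).

Definition free_vs S : vectType F := {ffun {x : T | x \in S} -> F^o}.

(* This is 0 when x is not in S. *)
Definition fvec S x : free_vs S := [ffun y => (val y == x)%:R].

Definition fext S (E : vectType F) (g : T -> E) : 'Hom(free_vs S, E) :=
  linfun (fun c : free_vs S => \sum_y (c y : F) *: g (val y)).
Arguments fext {S E} g.

Lemma fext_is_linear S (E : vectType F) (g : T -> E) :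
  linear (fun c : free_vs S => \sum_y (c y : F) *: g (val y)).
Proof.
move=> a c d; rewrite scaler_sumr -big_split /=; apply: eq_bigr => y _.
by rewrite !ffunE scalerDl scalerA.
Qed.

Lemma fextE S (E : vectType F) (g : T -> E) (c : free_vs S) :
  fext g c = \sum_y (c y : F) *: g (val y).
Proof.
pose M := GRing.isLinear.Build F (free_vs S) E _ _ (@fext_is_linear S E g).
pose l : {linear free_vs S -> E} := HB.pack
  (fun c : free_vs S => \sum_y (c y : F) *: g (val y)) M.
exact: (lfunE l c).
Qed.

Lemma fvec_notin S x : x \notin S -> fvec S x = 0.
Proof.
move=> xS; apply/ffunP => y; rewrite !ffunE.
by case: eqP => // yx; rewrite -yx (valP y) in xS.
Qed.

Lemma fext_fvec S (E : vectType F) (g : T -> E) x :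
  x \in S -> fext g (fvec S x) = g x.
Proof.
move=> xS; rewrite fextE (bigD1 (exist _ x xS)) //= ffunE eqxx scale1r.
rewrite big1 ?addr0 // => y /negP yx; rewrite ffunE.
by case: eqP => [e|_]; [case: yx; apply/eqP/val_inj | rewrite scale0r].
Qed.

Lemma free_vsE S (c : free_vs S) : c = \sum_y (c y : F) *: fvec S (val y).
Proof.
apply/ffunP => z; rewrite sum_ffunE (bigD1 z) //= !ffunE eqxx.
rewrite big1 => [|y /negP yz]; first by rewrite addr0; apply/esym/mulr1.
rewrite !ffunE; case: eqP => [e|_]; first by case: yz; apply/eqP/val_inj.
exact: mulr0.
Qed.

Lemma free_lfunP S (E : vectType F) (g h : 'Hom(free_vs S, E)) :
  (forall x, x \in S -> g (fvec S x) = h (fvec S x)) -> g = h.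
Proof.
move=> gh; apply/lfunP => c; rewrite [c]free_vsE !linear_sum /=.
by apply: eq_bigr => y _; rewrite !linearZ /= gh //; apply: valP.
Qed.

Lemma dim_free_vs S : \dim {: free_vs S} = #|S|.
Proof. by rewrite dimvf /dim /= muln1 card_sig; apply: eq_card. Qed.

End FreeVectorSpace.
Arguments fext {F T S E} g.

(* Simplices are oriented by the enumeration order of their vertex type. *)
Definition before (V : finType) (v w : V) : bool :=
  (enum_rank v < enum_rank w)%N.

Section Signs.
Variable F : fieldType.

(* [bd_sign sg v] is (-1)^i, where v is the i-th vertex of the simplex sg. *)
Definition bd_sign (V : finType) (sg : {set V}) (v : V) : F :=
  (-1) ^+ #|[set w in sg | before w v]%SET|.

(* When f is injective on sg, the sign (computed by counting inversions) of the
   permutation that sorts the images of the vertices of sg. *)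
Definition map_sign (V W : finType) (f : V -> W) (sg : {set V}) : F :=
  (-1) ^+ #|[set p : V * V | [&& p.1 \in sg, p.2 \in sg,
                                 before p.1 p.2 & before (f p.2) (f p.1)]]%SET|.

Lemma before_total (V : finType) (v w : V) : v != w -> before w v = ~~ before v w.
Proof.
move=> vw; rewrite /before; case: ltngtP => // /ord_inj/enum_rank_inj e.
by rewrite e eqxx in vw.
Qed.

Lemma beforexx (V : finType) (v : V) : before v v = false.
Proof. exact: ltnn. Qed.

Lemma prod_sign (I : finType) (P Q : pred I) :
  \prod_(i | P i) (-1) ^+ Q i = (-1) ^+ #|[set i | P i & Q i]%SET| :> F.
Proof.
rewrite -prodr_const big_mkcond [RHS]big_mkcond /=; apply: eq_bigr => i _.
by rewrite inE; case: (P i); case: (Q i).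
Qed.

Lemma bd_signE (V : finType) (sg : {set V}) v :
  bd_sign sg v = \prod_(w in sg) (-1) ^+ before w v.
Proof. by rewrite prod_sign. Qed.

Lemma bd_signD1 (V : finType) (sg : {set V}) v w : w \in sg ->
  bd_sign sg v = (-1) ^+ before w v * bd_sign (sg :\ w) v.
Proof. by move=> wsg; rewrite !bd_signE (big_setD1 w). Qed.

Lemma bd_signD1x (V : finType) (sg : {set V}) v : bd_sign (sg :\ v) v = bd_sign sg v.
Proof.
have [vsg|vsg] := boolP (v \in sg); first by rewrite (bd_signD1 _ vsg) beforexx mul1r.
by congr bd_sign; apply/setP => w; rewrite !inE; case: eqP => // ->; rewrite (negPf vsg).
Qed.

Lemma sign_sqr (b : bool) : (-1) ^+ b * (-1) ^+ b = 1 :> F.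
Proof. by case: b; rewrite ?mulrNN mulr1. Qed.

Lemma bd_sign_sqr (V : finType) (sg : {set V}) v : bd_sign sg v * bd_sign sg v = 1.
Proof. by rewrite -expr2 -exprM mulnC exprM sqrrN expr1n expr1n. Qed.

Section TwoTypes.
Variables (V W : finType) (f : V -> W).
Implicit Types (sg : {set V}) (v w : V).

Lemma map_signE sg : map_sign f sg =
  \prod_(v in sg) \prod_(w in sg) (-1) ^+ (before v w && before (f w) (f v)).
Proof.
rewrite pair_big /= prod_sign; congr (_ ^+ _).
by apply: eq_card => p; rewrite !inE -andbA.
Qed.

Let h v w : F := (-1) ^+ (before v w && before (f w) (f v)) *
                 (-1) ^+ (before w v && before (f v) (f w)).

Lemma map_signD1 sg v : v \in sg ->
  map_sign f sg = map_sign f (sg :\ v) * \prod_(w in sg :\ v) h v w.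
Proof.
move=> vsg; rewrite !map_signE (big_setD1 v) //= (big_setD1 v) //= beforexx mul1r.
under [X in _ * X = _]eq_bigr => w _ do rewrite (big_setD1 v) //=.
by rewrite !big_split /= [LHS]mulrA [LHS]mulrC.
Qed.

Lemma hE v w : v != w -> f v != f w ->
  h v w = (-1) ^+ before w v * (-1) ^+ before (f w) (f v).
Proof.
move=> vw fvw; rewrite /h (before_total vw) (before_total fvw).
by case: (before v w); case: (before (f v) (f w)); rewrite /= ?mulr1 ?mul1r ?mulrNN ?mulr1.
Qed.

Lemma card_imset_inj sg : #|f @: sg|%SET = #|sg| -> {in sg &, injective f}.
Proof. by move=> e; apply/imset_injP/eqP. Qed.

Lemma map_sign_face sg v : v \in sg -> {in sg &, injective f} ->
  bd_sign sg v * map_sign f (sg :\ v) =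
  map_sign f sg * bd_sign (f @: sg)%SET (f v).
Proof.
move=> vsg finj; rewrite (map_signD1 vsg).
have -> : \prod_(w in sg :\ v) h v w =
    bd_sign sg v * bd_sign (f @: sg)%SET (f v).
  rewrite -bd_signD1x -[X in _ * X]bd_signD1x !bd_signE.
  have -> : (f @: sg :\ f v = f @: (sg :\ v))%SET.
    apply/setP => y; apply/setD1P/imsetP => [[yv /imsetP[w wsg yE]]|[w /setD1P[wv wsg] ->]].
      by exists w => //; rewrite !inE wsg andbT; apply: contra_neq yv => <-.
    by split; [apply: contra_neq wv => /(finj _ _ wsg vsg) | apply: imset_f].
  rewrite big_imset /=; last by move=> a b /setD1P[_ a1] /setD1P[_ b1]; apply: finj.
  rewrite -big_split /=; apply: eq_bigr => w /setD1P[wv wsg]; apply: hE.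
    by rewrite eq_sym.
  by apply: contra_neq wv => /(finj _ _ vsg wsg).
by rewrite -!mulrA bd_sign_sqr mulr1 mulrC.
Qed.

Lemma map_sign_collapse sg a b : a \in sg -> b \in sg -> a != b ->
  f a = f b -> {in sg :\ b &, injective f} ->
  bd_sign sg a * map_sign f (sg :\ a) + bd_sign sg b * map_sign f (sg :\ b) = 0.
Proof.
move=> asg bsg ab fab finj.
have bsa : b \in sg :\ a by rewrite !inE eq_sym ab.
have asb : a \in sg :\ b by rewrite !inE ab.
pose Q := \prod_(w in sg :\ a :\ b) (-1) ^+ before (f w) (f a) : F.
have C : sg :\ b :\ a = sg :\ a :\ b by apply/setP => w; rewrite !inE andbCA.
have fne w : w \in sg :\ a :\ b -> f a != f w.
  rewrite !inE => /and3P[wb wa wsg]; apply: contra_neq wa => faw.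
  by apply/esym/finj => //; rewrite !inE wb.
have Ha : \prod_(w in sg :\ b :\ a) h a w = bd_sign (sg :\ a :\ b) a * Q.
  rewrite C bd_signE -big_split /=; apply: eq_bigr => w wt; apply: hE (fne _ wt).
  by move: wt; rewrite !inE => /and3P[_ wa _]; rewrite eq_sym.
have Hb : \prod_(w in sg :\ a :\ b) h b w = bd_sign (sg :\ a :\ b) b * Q.
  rewrite /Q fab bd_signE -big_split /=; apply: eq_bigr => w wt.
  apply: hE; last by rewrite -fab; exact: fne.
  by move: wt; rewrite !inE => /and3P[wb _ _]; rewrite eq_sym.
rewrite (map_signD1 bsa) (map_signD1 asb) Ha Hb C.
rewrite -(bd_signD1x sg a) -(bd_signD1x sg b) (bd_signD1 a bsa) (bd_signD1 b asb) C.
rewrite (before_total ab).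
by case: (before a b) => /=; ring.
Qed.

End TwoTypes.

Lemma map_sign_section (V W : finType) (f : V -> W) (s : W -> V)
    (ta : {set W}) : cancel s f ->
  map_sign s ta * map_sign f (s @: ta)%SET = 1.
Proof.
move=> sK; have sinj : {in ta &, injective s} by move=> x y _ _; apply: (can_inj sK).
rewrite !map_signE big_imset //=.
under [X in _ * X]eq_bigr => v _ do (rewrite big_imset //=; under eq_bigr => w _ do rewrite !sK).
rewrite exchange_big /= -big_split /= big1 // => v _.
rewrite -big_split /= big1 // => w _; rewrite [before (s v) _ && _]andbC; exact: sign_sqr.
Qed.

End Signs.

Section FilteredSimplicialComplexes.
Variable R : realType.

(* A finite abstract simplicial complex with vertex set V; the values of ent
   outside the complex are irrelevant. *)
Record filtered_scomplex (V : finType) := FilteredSComplex {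
  simplices :> {set {set V}};
  simplex_neq0 : forall sg, sg \in simplices -> sg != finset.set0;
  simplex_face : forall sg ta : {set V},
    sg \in simplices -> ta \subset sg -> ta != finset.set0 -> ta \in simplices;
  simplex_vertex : forall v, [set v]%SET \in simplices;
  ent : {set V} -> {nonneg R};
  ent_face : forall sg ta : {set V},
    sg \in simplices -> ta \subset sg -> ta != finset.set0 -> ent ta <= ent sg
}.

Record simplicial_map (V W : finType)
    (K : filtered_scomplex V) (L : filtered_scomplex W) := SimplicialMap {
  sm_fun :> V -> W;
  sm_simplex : forall sg : {set V}, sg \in K -> (sm_fun @: sg)%SET \in L;
  sm_ent : forall sg : {set V}, sg \in K -> ent L (sm_fun @: sg)%SET <= ent K sg
}.

Definition sdim (V : finType) (sg : {set V}) : nat := #|sg|.-1.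

Section Chains.
Variables (F : fieldType) (V : finType) (K : filtered_scomplex V).
Implicit Types (sg ta : {set V}) (s t : {nonneg R}) (n : nat).

Definition simps n t : {set {set V}} :=
  [set sg in K | (sdim sg == n) && (ent K sg <= t)]%SET.

Definition chains n t : vectType F := free_vs F (simps n t).

Definition simplex_chain n t sg : chains n t := fvec F (simps n t) sg.

Definition boundary n t : 'Hom(chains n.+1 t, chains n t) :=
  fext (fun sg => \sum_(v in sg) bd_sign F sg v *: simplex_chain n t (sg :\ v)).

Definition chains_tr s t n : 'Hom(chains n s, chains n t) :=
  fext (simplex_chain n t).

Lemma simpsP n t sg :
  reflect [/\ sg \in K, #|sg| = n.+1 & ent K sg <= t] (sg \in simps n t).
Proof.
rewrite inE; apply: (iffP and3P) => [[sK /eqP <- st]|[sK sn st]]; split => //.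
  by rewrite prednK // card_gt0 (simplex_neq0 sK).
by rewrite /sdim sn.
Qed.

Lemma simps_face n t sg v : sg \in simps n.+1 t -> v \in sg ->
  sg :\ v \in simps n t.
Proof.
case/simpsP => sK sn st vs.
have cE : #|sg :\ v| = n.+1 by move: sn; rewrite (cardsD1 v) vs => -[].
have sv0 : sg :\ v != finset.set0 by rewrite -card_gt0 cE.
apply/simpsP; split => //; first exact: simplex_face sK (subD1set _ _) sv0.
exact: le_trans (ent_face sK (subD1set _ _) sv0) st.
Qed.

Lemma simps_le n s t sg : s <= t -> sg \in simps n s -> sg \in simps n t.
Proof. by move=> st /simpsP[? ? e]; apply/simpsP; split => //; apply: le_trans st. Qed.

Lemma boundary_simplex n t sg : sg \in simps n.+1 t ->
  boundary n t (simplex_chain n.+1 t sg) =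
  \sum_(v in sg) bd_sign F sg v *: simplex_chain n t (sg :\ v).
Proof. exact: fext_fvec. Qed.

Lemma chains_tr_simplex s t n sg : sg \in simps n s ->
  chains_tr s t n (simplex_chain n s sg) = simplex_chain n t sg.
Proof. exact: fext_fvec. Qed.

Lemma boundary_boundary n t : (boundary n t \o boundary n.+1 t = 0)%VF.
Proof.
apply: free_lfunP => sg sgS; rewrite comp_lfunE [RHS]lfunE /= boundary_simplex //.
pose G v w := bd_sign F sg v * bd_sign F (sg :\ v) w
  *: simplex_chain n t (sg :\ v :\ w).
have -> : boundary n t (\sum_(v in sg) bd_sign F sg v
    *: simplex_chain n.+1 t (sg :\ v)) = \sum_(v in sg) \sum_(w in sg :\ v) G v w.
  rewrite linear_sum; apply: eq_bigr => v vs.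
  rewrite linearZ /= boundary_simplex ?simps_face // scaler_sumr.
  by apply: eq_bigr => w ws; rewrite scalerA.
have swap_inj : injective (fun p : V * V => (p.2, p.1)).
  by move=> [a b] [c d] [-> ->].
rewrite pair_big_dep /= (bigID (fun p : V * V => before p.1 p.2)) /=.
rewrite [X in _ + X](reindex_inj swap_inj) /=.
rewrite [X in _ + X](eq_bigl (fun p : V * V =>
    [&& p.1 \in sg, p.2 \in sg :\ p.1 & before p.1 p.2])); last first.
  move=> [v w] /=; rewrite !inE; case: (eqVneq v w) => [->|vw] /=.
    by rewrite !andbF.
  by rewrite (before_total vw); case: (v \in sg); case: (w \in sg); case: before.
rewrite [X in X + _](eq_bigl (fun p : V * V =>
    [&& p.1 \in sg, p.2 \in sg :\ p.1 & before p.1 p.2])); last first.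
  by move=> p; rewrite andbA.
rewrite -big_split big1 //= => -[v w] /and3P[/= vs ws vw].
move: ws; rewrite !inE eq_sym => /andP[wv ws]; rewrite /G.
have -> : sg :\ w :\ v = sg :\ v :\ w by apply/setP => u; rewrite !inE andbCA.
rewrite -scalerDl (bd_signD1 F v ws) (bd_signD1 F w vs) (before_total wv) vw /=.
by rewrite expr0 expr1 !mul1r mulN1r mulNr [X in X - _]mulrC subrr scale0r.
Qed.

Lemma chains_compact t : exists N, forall n, (N <= n)%N ->
  \dim {: chains n t} = 0%N.
Proof.
exists #|V| => n Vn; rewrite dim_free_vs; apply/eqP; rewrite cards_eq0.
apply/set0Pn => -[sg /simpsP[_ sn _]].
by have := max_card (mem sg); rewrite sn leqNgt ltnS Vn.
Qed.

Definition simplicial_complex_at t : chain_complex F :=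
  @ChainComplex F (fun n => chains n t) (fun n => boundary n t)
    (fun n => boundary_boundary n t) (chains_compact t).

Lemma chains_tr_d s t (st : s <= t) n :
  (chains_tr s t n \o boundary n s = boundary n t \o chains_tr s t n.+1)%VF.
Proof.
apply: free_lfunP => sg sgS; rewrite !comp_lfunE /= boundary_simplex //.
rewrite chains_tr_simplex // boundary_simplex ?(simps_le st) // linear_sum.
by apply: eq_bigr => v vs; rewrite linearZ /= chains_tr_simplex // simps_face.
Qed.

Definition simplicial_transition s t (st : s <= t) :
    chain_map (simplicial_complex_at s) (simplicial_complex_at t) :=
  @ChainMap F (simplicial_complex_at s) (simplicial_complex_at t)
    (fun n => chains_tr s t n) (chains_tr_d st).

Lemma chains_tr_id t (tt : t <= t) n : simplicial_transition tt n = \1%VF.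
Proof.
by apply: free_lfunP => sg sgS; rewrite id_lfunE; apply: chains_tr_simplex.
Qed.

Lemma chains_tr_comp r s t (rs : r <= s) (st : s <= t) (rt : r <= t) n :
  simplicial_transition rt n =
  (simplicial_transition st n \o simplicial_transition rs n)%VF.
Proof.
apply: free_lfunP => sg sgS; rewrite comp_lfunE /=.
by rewrite !chains_tr_simplex // (simps_le rs).
Qed.

Definition simplicial_pers : pers_complex F R :=
  @PersComplex F R simplicial_complex_at simplicial_transition
    chains_tr_id chains_tr_comp.

Lemma chains_tr_inj s t (st : s <= t) n : injective (chains_tr s t n).
Proof.
move=> c d /ffunP cd; apply/ffunP => -[sg sgS]; have sgT := simps_le st sgS.
have E (x : chains n s) : (chains_tr s t n x : {ffun _ -> _}) (exist _ sg sgT) = x (exist _ sg sgS).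
  rewrite /chains_tr fextE sum_ffunE (bigD1 (exist _ sg sgS)) //= !ffunE eqxx.
  rewrite big1 => [|y /negP ny]; first by rewrite addr0; apply: mulr1.
  rewrite !ffunE /=; case: eqP => [e|_]; last exact: mulr0.
  by case: ny; apply/eqP/val_inj.
by rewrite -!E cd.
Qed.

Lemma simplicial_tame : tame simplicial_pers.
Proof.
pose T := [seq a <- [seq ent K sg | sg <- enum (K : {set {set V}})] | 0 < a%:num].
exists (sort <=%O (undup T)).
  rewrite path_min_sorted; last first.
    by apply/allP => a; rewrite mem_sort mem_undup mem_filter => /andP[].
  by rewrite lt_sorted_uniq_le sort_uniq undup_uniq sort_le_sorted.
move=> s t st notin; apply: chain_iso_bij => n; split; first exact: chains_tr_inj.
apply/eqP; rewrite eqEsubv subvf /=; apply/subvP => c _.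
rewrite [c]free_vsE; apply: memv_suml => -[sg sgS] _; apply: memvZ => /=.
apply/memv_imgP; exists (simplex_chain n s sg); first exact: memvf.
case/simpsP: (sgS) => sK sn sgt; rewrite chains_tr_simplex //.
apply/simpsP; split => //; rewrite leNgt; apply/negP => ssg.
apply: (notin (ent K sg)); last by rewrite ssg sgt.
rewrite mem_sort mem_undup mem_filter map_f ?mem_enum // andbT.
by apply: (@le_lt_trans _ _ s%:num).
Qed.

Definition simplicial_filtered_complex : filtered_complex F R :=
  FilteredComplex simplicial_tame chains_tr_inj.

End Chains.

Section InducedMap.
Variables (F : fieldType) (V W : finType).
Variables (K : filtered_scomplex V) (L : filtered_scomplex W).
Variable f : simplicial_map K L.
Implicit Types (sg ta : {set V}) (s t : {nonneg R}) (n : nat).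

Definition induced_map n t : 'Hom(chains F K n t, chains F L n t) :=
  fext (fun sg => if sdim (f @: sg)%SET == n
                  then map_sign F f sg *: simplex_chain F L n t (f @: sg)%SET
                  else 0).

Lemma simps_imset n t sg : sg \in simps K n t ->
  (sdim (f @: sg)%SET == n) = (#|f @: sg|%SET == n.+1).
Proof.
move=> /simpsP[sK _ _]; have /simplex_neq0 := sm_simplex f sK.
by rewrite /sdim -card_gt0; case: #|_|%SET.
Qed.

Lemma simps_imset_mem n t sg : sg \in simps K n t -> #|f @: sg|%SET = n.+1 ->
  (f @: sg)%SET \in simps L n t.
Proof.
move=> /simpsP[sK sn st] fn; apply/simpsP; split => //; first exact: sm_simplex.
exact: le_trans (sm_ent f sK) st.
Qed.

Lemma induced_map_simplex n t sg : sg \in simps K n t ->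
  induced_map n t (simplex_chain F K n t sg) =
  if #|f @: sg|%SET == n.+1
  then map_sign F f sg *: simplex_chain F L n t (f @: sg)%SET else 0.
Proof. by move=> sgS; rewrite [LHS]fext_fvec // (simps_imset sgS). Qed.

Lemma induced_map_d n t :
  (induced_map n t \o boundary F K n t =
   boundary F L n t \o induced_map n.+1 t)%VF.
Proof.
apply: free_lfunP => sg sgS; rewrite [LHS]comp_lfunE [RHS]comp_lfunE.
rewrite boundary_simplex // induced_map_simplex // linear_sum /=.
have [_ sn _] := simpsP _ _ _ _ sgS.
have cD v : v \in sg -> #|sg :\ v| = n.+1.
  by move=> vs; move: sn; rewrite (cardsD1 v) vs => -[].
have -> : \sum_(v in sg) induced_map n t
      (bd_sign F sg v *: simplex_chain F K n t (sg :\ v)) =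
    \sum_(v in sg) (if #|f @: (sg :\ v)|%SET == n.+1 then
      (bd_sign F sg v * map_sign F f (sg :\ v)) *:
        simplex_chain F L n t (f @: (sg :\ v))%SET else 0).
  apply: eq_bigr => v vs; rewrite linearZ /= induced_map_simplex ?simps_face //.
  by case: ifP; rewrite ?scalerA ?scaler0.
have injE v : v \in sg -> (#|f @: (sg :\ v)|%SET == n.+1) -> {in sg :\ v &, injective f}.
  by move=> vs /eqP e; apply: card_imset_inj; rewrite cD.
have Einj v : v \in sg -> {in sg :\ v &, injective f} -> #|f @: (sg :\ v)|%SET == n.+1.
  by move=> vs /card_in_imset ->; rewrite cD.
case: ifP => [/eqP fn|/negP nfn].
  have finj : {in sg &, injective f} by apply: card_imset_inj; rewrite fn sn.
  rewrite linearZ /= boundary_simplex ?simps_imset_mem // scaler_sumr.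
  rewrite [RHS]big_imset //=; apply: eq_bigr => v vs.
  rewrite Einj //; last by move: finj; apply: sub_in2 => w /setD1P[].
  rewrite map_sign_face // scalerA; congr (_ *: simplex_chain _ _ _ _ _).
  apply/setP => y; apply/imsetP/setD1P => [[w /setD1P[wv wsg] ->]|[yv /imsetP[w wsg yE]]].
    by split; [apply: contra_neq wv => /(finj _ _ wsg vs) | apply: imset_f].
  by exists w => //; rewrite !inE wsg andbT; apply: contra_neq yv => <-.
rewrite linear0.
have /dinjectivePn[a asg [b /andP[/= ba bsg] fab]] : ~~ dinjectiveb f sg.
  by apply/negP => /dinjectiveP /card_in_imset fE; apply: nfn; rewrite fE sn.
have ab : a != b by rewrite eq_sym.
have asb : a \in sg :\ b by rewrite !inE ab.
have bsa : b \in sg :\ a by rewrite !inE ba.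
have fabE : (f @: (sg :\ a) = f @: (sg :\ b))%SET.
  apply/setP => y; apply/imsetP/imsetP => -[w /setD1P[wn wsg] ->].
    case: (eqVneq w b) => [->|wb]; first by exists a.
    by exists w => //; rewrite !inE wb.
  case: (eqVneq w a) => [->|wa]; first by exists b.
  by exists w => //; rewrite !inE wa.
have big0 v : v \in sg -> v != a -> v != b ->
    (#|f @: (sg :\ v)|%SET == n.+1) = false.
  move=> vs va vb; apply/negP => /(injE _ vs) finj.
  have: a = b by apply: finj => //; rewrite !inE eq_sym ?va ?vb.
  by apply/eqP.
rewrite (bigD1 a) //= (bigD1 b) /=; last by rewrite bsg ba.
rewrite big1 ?addr0 => [|v /andP[/andP[vs va] vb]]; last by rewrite big0.
rewrite fabE; case: ifP => [e|_]; last by rewrite addr0.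
rewrite -scalerDl map_sign_collapse ?scale0r //.
exact: injE e.
Qed.

Definition induced_chain_map t :
    chain_map (simplicial_complex_at F K t) (simplicial_complex_at F L t) :=
  @ChainMap F (simplicial_complex_at F K t) (simplicial_complex_at F L t)
    (fun n => induced_map n t) (fun n => induced_map_d n t).

Lemma induced_map_tr s t (st : s <= t) n :
  (induced_map n t \o chains_tr F K s t n =
   chains_tr F L s t n \o induced_map n s)%VF.
Proof.
apply: free_lfunP => sg sgS; rewrite [LHS]comp_lfunE [RHS]comp_lfunE.
rewrite chains_tr_simplex // !induced_map_simplex //; last exact: simps_le sgS.
case: ifP => [/eqP e|_]; last by rewrite linear0.
by rewrite linearZ /= chains_tr_simplex // simps_imset_mem.
Qed.

Definition induced_pers_map :
    pers_map (simplicial_filtered_complex F K) (simplicial_filtered_complex F L) :=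
  @PersMap F R (simplicial_filtered_complex F K)
    (simplicial_filtered_complex F L) induced_chain_map induced_map_tr.

End InducedMap.

Section SectionOfMap.
Variables (F : fieldType) (V W : finType).
Variables (K : filtered_scomplex V) (L : filtered_scomplex W).
Variables (f : simplicial_map K L) (s : simplicial_map L K).
Implicit Types (sg ta : {set V}) (t : {nonneg R}) (n : nat).

Definition section_image : {set {set V}} :=
  [set (s @: ta)%SET | ta : {set W} in simplices L]%SET.

Definition section_diff n t sg : chains F K n t :=
  simplex_chain F K n t sg -
  induced_map F s n t (induced_map F f n t (simplex_chain F K n t sg)).

Lemma section_diff_tr (r t : {nonneg R}) (rt : r <= t) n sg : sg \in simps K n r ->
  chains_tr F K r t n (section_diff n r sg) = section_diff n t sg.
Proof.
move=> sgS; rewrite linearB /= chains_tr_simplex //; congr (_ - _).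
rewrite -[LHS]comp_lfunE -induced_map_tr // comp_lfunE.
congr (induced_map F s n t _).
by rewrite -[LHS]comp_lfunE -induced_map_tr // comp_lfunE /= chains_tr_simplex.
Qed.

Hypothesis sK : cancel s f.

Lemma induced_map_section n t :
  (induced_map F f n t \o induced_map F s n t = \1)%VF.
Proof.
apply: free_lfunP => ta taS; rewrite comp_lfunE id_lfunE induced_map_simplex //.
have cE : #|s @: ta|%SET = n.+1.
  by have [_ <- _] := simpsP _ _ _ _ taS; rewrite card_imset //; apply: can_inj sK.
have fsE : (f @: (s @: ta) = ta)%SET.
  by rewrite -imset_comp (eq_imset (g := id)) ?imset_id.
rewrite cE eqxx linearZ /= induced_map_simplex ?simps_imset_mem // fsE.
have [_ -> _] := simpsP _ _ _ _ taS.
by rewrite eqxx scalerA map_sign_section // scale1r.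
Qed.

Lemma section_diff_ker n t sg : section_diff n t sg \in lker (induced_map F f n t).
Proof.
rewrite memv_ker linearB /= -[X in _ - X]comp_lfunE induced_map_section.
by rewrite id_lfunE subrr.
Qed.

Local Open Scope classical_set_scope.

Definition section_generator sg :
    generator (filtered_kernel (induced_pers_map F f)) :=
  @Generator F R (filtered_kernel (induced_pers_map F f)) (sdim sg) (ent K sg)
    (Subvs (section_diff_ker (sdim sg) (ent K sg) sg)).

Definition section_generators :
    set (generator (filtered_kernel (induced_pers_map F f))) :=
  [set section_generator sg | sg in
    [set sg : {set V} | sg \in K /\ sg \notin section_image]].

End SectionOfMap.

End FilteredSimplicialComplexes.

Arguments section_generator {R} F {V W K L f s} sK sg.
Arguments section_generators {R} F {V W K L f s} sK.

(* Main.v *)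
(** The endomorphism c |-> c - s f c of the chains of K projects onto ker f. It
    kills the simplices in the image of s, and on the remaining simplices it
    only adds a multiple of a simplex in that image, so the elements
    sigma - s f sigma form a basis of ker f at every time t. The radical of
    ker f at t is spanned by the basis elements with entrance time < t, hence
    those with entrance time t project onto a basis of the quotient. *)

Require Import Defs.
From mathcomp Require Import all_boot all_order all_algebra.
From mathcomp Require Import boolp classical_sets functions cardinality reals.
From mathcomp Require Import interval_inference.

Set Implicit Arguments.
Unset Strict Implicit.
Unset Printing Implicit Defensive.

Import Order.TTheory GRing.Theory Num.Theory.

Local Open Scope ring_scope.

(** * Linear algebra: dual families, bases of subspaces and of quotients *)

Lemma uniq_map_inj_in (T1 T2 : eqType) (g : T1 -> T2) (e : seq T1) :
  uniq (map g e) -> {in e &, injective g}.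
Proof.
elim: e => //= z e IH /andP[gz ue] x y.
rewrite !inE => /predU1P[->|xe] /predU1P[->|ye] //; last exact: IH.
- by move=> gE; rewrite gE map_f in gz.
- by move=> gE; rewrite -gE map_f in gz.
Qed.

Section Bases.
Variables (F : fieldType) (V : vectType F).

(** Applying [phi i] to a vanishing combination isolates the coefficient of [b i]. *)
Lemma free_dual_family (I : eqType) (e : seq I) (b : I -> V)
    (phi : I -> 'Hom(V, F^o)) : uniq e ->
  {in e &, forall i j, phi i (b j) = (i == j)%:R} -> free (map b e).
Proof.
move=> ue dual; have [->|[i0 _]] : e = [::] \/ exists i0, i0 \in e.
- by case: e {ue dual} => [|i e]; [left | right; exists i; apply: mem_head].
- exact: nil_free.
have lt_e (i : 'I_(size (map b e))) : (i < size e)%N.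
  by rewrite -(size_map b) ltn_ord.
have -> : map b e = in_tuple (map b e) by [].
apply/freeP => k k0 i.
have E j : phi (nth i0 e i) (k j *: (map b e)`_j) = k j * (i == j)%:R.
  rewrite linearZ /= (nth_map i0) ?lt_e // dual ?mem_nth ?lt_e //.
  by rewrite nth_uniq ?lt_e // (inj_eq val_inj).
move/(congr1 (phi (nth i0 e i))): k0; rewrite linear_sum linear0 => <-.
rewrite (bigD1 i) //= E eqxx mulr1 big1 ?addr0 // => j ji.
by rewrite E eq_sym (negPf ji) mulr0.
Qed.

Lemma basis_of_subvs (A : {vspace V}) (b : seq (subvs_of A)) :
  basis_of A (map vsval b) -> basis_of fullv b.
Proof.
move=> /andP[/eqP spanb freeb]; rewrite basisEdim; apply/andP; split.
  apply/subvP => v _.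
  have : vsval v \in (linfun (vsval : subvs_of A -> V) @: <<b>>)%VS.
    rewrite limg_span (eq_map (g := vsval)) ?spanb ?subvsP // => x.
    by rewrite lfunE.
  by case/memv_imgP => w wb; rewrite lfunE /= => /subvs_inj ->.
by rewrite dimvf /dim /= -[X in \dim X]spanb (eqnP freeb) size_map.
Qed.

(** [b1] vanishes in the quotient, so the images of [b2] span it; a dimension count makes this
    spanning family a basis. *)
Lemma basis_quo (U : {vspace V}) (b1 b2 : seq V) :
  basis_of fullv (b1 ++ b2) -> <<b1>>%VS = U ->
  basis_of fullv (map (quo_proj U) b2).
Proof.
move=> b12 spanb1; rewrite basisEdim size_map; apply/andP; split.
  rewrite -limg_quo_proj -(span_basis b12) limg_span map_cat span_cat.
  have /eqP-> : (<<map (quo_proj U) b1>> == 0)%VS.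
    by rewrite -limg_span spanb1 -lkerE lker_quo_proj subvv.
  by rewrite add0v subvv.
(* Rank-nullity gives dim V = dim U + dim V/U, and [b1], being free, has dim U elements; hence [b2]
   has dim V/U elements. *)
have := limg_ker_dim (quo_proj U) fullv.
rewrite limg_quo_proj lker_quo_proj capfv => dimE.
have := basis_free b12; rewrite cat_free => /and3P[/eqnP f1 _ _].
move: (@size_basis _ _ _ _ (in_tuple (b1 ++ b2)) b12); rewrite size_cat -f1 spanb1 -dimE => /eqP.
by rewrite eqn_add2l => /eqP ->.
Qed.

End Bases.

(** * The basis of the kernel at a fixed time *)

Section SectionKernel.
Variables (F : fieldType) (R : realType) (V W : finType).
Variables (K : filtered_scomplex R V) (L : filtered_scomplex R W).
Variables (f : simplicial_map K L) (s : simplicial_map L K).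
Hypothesis sK : cancel s f.
Implicit Types (sg : {set V}) (ta : {set W}) (r t : {nonneg R}) (n : nat).

Local Notation kerf := (filtered_kernel (induced_pers_map F f)).
Local Notation G := (section_generators F sK).

Definition simplex_coord n t sg : 'Hom(chains F K n t, F^o) :=
  fext (fun ta : {set V} => (sg == ta)%:R : F^o).

(** The chain map of [s] sends a simplex to zero or to a multiple of a simplex in the image of [s],
    which is never [sg]. *)
Lemma simplex_coord_section n t sg c : sg \notin section_image s ->
  simplex_coord n t sg (induced_map F s n t c) = 0.
Proof.
move=> sgs; suff z : (simplex_coord n t sg \o induced_map F s n t = 0)%VF.
  by rewrite -comp_lfunE z lfunE.
apply: free_lfunP => ta taS; rewrite comp_lfunE [RHS]lfunE induced_map_simplex //.
case: ifP => [/eqP card_sta|_]; last by rewrite linear0.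
rewrite linearZ /= /simplex_coord fext_fvec ?simps_imset_mem //.
case: eqP => [sgE|_]; last by rewrite scaler0.
by case/negP: sgs; rewrite sgE imset_f //; case/simpsP: taS.
Qed.

Lemma imset_sectionK ta : (f @: (s @: ta) = ta)%SET.
Proof. by rewrite -imset_comp (eq_imset (g := id)) ?imset_id. Qed.

(** For [sg] the image of [ta], applying f and then s returns to [sg], and the two orientation signs
    multiply to 1. *)
Lemma section_diff_image n t sg : sg \in simps K n t ->
  sg \in section_image s -> section_diff F f s n t sg = 0.
Proof.
move=> sgS /imsetP[ta taL sgE]; rewrite sgE in sgS *.
have [staK card_sta ent_sta] := simpsP _ _ _ _ sgS.
have card_ta : #|ta| = n.+1 by rewrite -card_sta card_imset //; apply: can_inj sK.
(* As f does not raise entrance times, [ta] enters no later than its image under [s]. *)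
have taS : ta \in simps L n t.
  apply/simpsP; split => //; apply: le_trans ent_sta.
  by have := sm_ent f staK; rewrite imset_sectionK.
rewrite /section_diff induced_map_simplex // imset_sectionK card_ta eqxx linearZ /=.
rewrite induced_map_simplex // card_sta eqxx scalerA mulrC map_sign_section //.
by rewrite scale1r subrr.
Qed.

Lemma basis_section_diff n t :
  basis_of (lker (induced_pers_map F f t n))
    [seq section_diff F f s n t sg | sg <- enum (simps K n t :\: section_image s)%SET].
Proof.
apply/andP; split; last first.
  (* The coordinates at the simplices outside the image of s are dual to the family: they vanish on
     the corrections s f sigma. *)
  apply: (@free_dual_family _ _ _ _ _ (simplex_coord n t)) (enum_uniq _) _.
  move=> sg sg'; rewrite !mem_enum !inE -/(section_image s).
  move=> /andP[sgs _] /andP[_ sgS'].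
  rewrite linearB /= simplex_coord_section // subr0.
  by rewrite /simplex_coord fext_fvec // inE.
rewrite eqEsubv; apply/andP; split.
  by apply/span_subvP => _ /mapP[sg _ ->]; apply: section_diff_ker.
apply/subvP => c; rewrite memv_ker => /eqP fc0.
(* [D] is linear and fixes ker f pointwise, so a cycle-free computation on single simplices suffices
   for spanning. *)
pose D := (\1 - (induced_map F s n t \o induced_map F f n t))%VF.
have DE x : D x = x - induced_map F s n t (induced_map F f n t x).
  by rewrite add_lfunE opp_lfunE id_lfunE comp_lfunE.
have -> : c = D c by rewrite DE [induced_map F f n t c]fc0 linear0 subr0.
rewrite [c]free_vsE linear_sum; apply: memv_suml => -[sg sgS] _.
rewrite linearZ /= memvZ // DE.
have [sgs|sgs] := boolP (sg \in section_image s).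
  by have := section_diff_image sgS sgs; rewrite /section_diff => ->; apply: mem0v.
by apply: memv_span; apply: map_f; rewrite mem_enum finset.in_setD sgs.
Qed.

(** * Generators, radical and quasi-minimality *)

Definition ker_diff n t sg : kerf t n := Subvs (section_diff_ker F sK n t sg).

Lemma basis_ker_diff n t : basis_of fullv
  [seq ker_diff n t sg | sg <- enum (simps K n t :\: section_image s)%SET].
Proof.
by apply: basis_of_subvs; rewrite -map_comp; apply: basis_section_diff.
Qed.

Lemma ker_diff_tr r t (rt : r <= t) n sg : sg \in simps K n r ->
  pc_tr kerf rt n (ker_diff n r sg) = ker_diff n t sg.
Proof.
move=> sgS; apply: subvs_inj; rewrite /= subvs_mapE; last exact: (ker_tr (f := induced_pers_map F f)).
exact: section_diff_tr.
Qed.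

Lemma gens_at_section n t (x : kerf t n) : gens_at G x <->
  exists sg, [/\ sg \in K, sg \notin section_image s, sdim sg = n,
                ent K sg = t & x = ker_diff n t sg].
Proof.
split => [|[sg [sgK sgs sgn sgt ->]]].
  (* The type of [gen_elt] depends on the degree and entrance time, so an equation between
     generators is not split into components; a predicate on whole generators is transported along
     it. *)
  pose P (g : generator kerf) := exists sg, [/\ sg \in K,
    sg \notin section_image s, sdim sg = gen_deg g, ent K sg = gen_ent g
    & gen_elt g = ker_diff (gen_deg g) (gen_ent g) sg].
  suff GP g : G g -> P g by move=> /GP.
  by case=> sg [sgK sgs] <-; exists sg.
by subst n t; exists sg.
Qed.

Lemma generates_section : generates G.
Proof.
split=> [|n t v]; first exact/finite_image/finite_finset.
exists [seq ker_diff n t sg | sg <- enum (simps K n t :\: section_image s)%SET].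
split; last by rewrite (span_basis (basis_ker_diff n t)) memvf.
move=> _ /mapP[sg + ->]; rewrite mem_enum finset.in_setD => /andP[sgs sgS].
have [sgK sgn sgt] := simpsP _ _ _ _ sgS.
(* Each basis vector at [t] is the transition image of the generator born at [ent K sg]. *)
left; exists (ent K sg), sgt, (ker_diff n (ent K sg) sg).
  by apply/gens_at_section; exists sg; rewrite /sdim sgn.
by rewrite ker_diff_tr //; apply/simpsP.
Qed.

(** Transitions carry the basis at r < t to basis vectors entering by r; conversely, a basis vector
    entering before [t] comes from its own entrance time. *)
Lemma rad_section n t : Defs.rad kerf n t =
  <<[seq ker_diff n t sg | sg <- enum (simps K n t :\: section_image s)%SET
     & ent K sg < t]>>%VS.
Proof.
apply/eqP; rewrite eqEsubv; apply/andP; split.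
  apply/subvP => v /memv_sumv_fam[rs]; apply: subvP => {v}.
  elim: rs => [|[r rt] rs IH]; first by rewrite big_nil sub0v.
  rewrite big_cons subv_add IH andbT /=.
  rewrite -(span_basis (basis_ker_diff n r)) limg_span.
  apply/span_subvP => _ /mapP[_ /mapP[sg + ->] ->].
  rewrite mem_enum finset.in_setD => /andP[sgs sgS].
  rewrite (ker_diff_tr (ltW rt)) //; apply: memv_span; apply: map_f.
  rewrite mem_filter mem_enum finset.in_setD sgs (simps_le (ltW rt) sgS) !andbT.
  by apply: le_lt_trans rt; case/simpsP: sgS.
apply/span_subvP => _ /mapP[sg + ->].
rewrite mem_filter mem_enum finset.in_setD => /andP[sgt /andP[sgs sgS]].
apply/memv_sumv_fam; exists [:: exist _ (ent K sg) sgt].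
rewrite big_seq1; apply/memv_imgP; exists (ker_diff n (ent K sg) sg).
  exact: memvf.
by rewrite ker_diff_tr //; apply/simpsP; case/simpsP: sgS.
Qed.

(** The basis at [t] splits into vectors entering before [t], which span the radical, and those in
    [new], which therefore give a basis of the quotient. *)
Lemma quasi_minimal_section : quasi_minimal G.
Proof.
move=> n t; set e := enum (simps K n t :\: section_image s)%SET.
set new := [seq ker_diff n t sg | sg <- e & ~~ (ent K sg < t)].
have basis_new : basis_of fullv (map (quo_proj (Defs.rad kerf n t)) new).
  apply: basis_quo (esym (rad_section n t)); rewrite -map_cat.
  have := basis_ker_diff n t; rewrite -/e; congr is_true; apply: perm_basis.
  by apply: perm_map; rewrite perm_sym perm_filterC.
(* Simplices of [simps K n t] enter by [t], so not entering before [t] means entering exactly at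
   [t]. *)
have newE (x : kerf t n) : gens_at G x <-> x \in new.
  split => [/gens_at_section[sg [sgK sgs sgn sgt ->]]|/mapP[sg + ->]].
    apply/map_f; rewrite mem_filter sgt ltxx mem_enum finset.in_setD sgs /=.
    by rewrite inE sgK sgn eqxx sgt lexx.
  rewrite mem_filter mem_enum finset.in_setD -leNgt => /and3P[tsg sgs].
  case/simpsP=> sgK sgn sgt; apply/gens_at_section; exists sg; split => //.
    by rewrite /sdim sgn.
  by apply/le_anti; rewrite sgt.
split.
  move=> x y /[!inE] /newE xn /newE yn qxy.
  (* A basis has no repetitions, so the projection is injective on [new]. *)
  exact: (uniq_map_inj_in (free_uniq (basis_free basis_new))).
exists (map (quo_proj (Defs.rad kerf n t)) new); split => // y; split.
  by case=> x /newE xn <-; apply: map_f.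
by case/mapP=> x /newE xn ->; exists x.
Qed.

End SectionKernel.

Theorem mainTheorem3 (p : nat) (p_prime : prime p) (R : realType)
    (V W : finType) (K : filtered_scomplex R V) (L : filtered_scomplex R W)
    (f : simplicial_map K L) (s : simplicial_map L K) (sK : cancel s f) :
  let kerf := filtered_kernel (induced_pers_map 'F_p f) in
  let G : set (generator kerf) := section_generators 'F_p sK in
  generates G /\ quasi_minimal G /\
  forall (n : nat) (t : {nonneg R}),
    basis_of (lker (induced_pers_map 'F_p f t n))
      [seq section_diff 'F_p f s n t sg
         | sg <- enum (simps K n t :\: section_image s)%SET].
Proof.
move=> kerf G; split; first exact: generates_section.
by split; [exact: quasi_minimal_section | exact: basis_section_diff].
Qed.
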